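(* Let $r\geq 2$ and $\delta>0$ be integers. (1) Suppose $r^2<\delta<(r+1)^2$ and $\delta-r$ is odd. Let $m,n,q$ be integers with $m\geq(\delta-r+1)/2$, $q\geq(\delta-r+1)/2$ and $n=r$. Put $\tau_1:=m-(\delta-r+1)/2$, $\tau_2:=q-(\delta-r+1)/2$ and $d:=\delta+\tau_1+\tau_2$ (so that $m+n+q=d+1$). Then for every triple of nonnegative integers $(m^*,n^*,q^* )$ with $m^*+n^*+q^*=d-2$, $m^*\geq\tau_1$ and $q^*\geq\tau_2$, the sign pattern $\Sigma_{m,n,q}$ is realizable by a degree $d$ hyperbolic polynomial, with pairwise distinct moduli of roots, having these values of $m^*,n^*,q^*$. (2) Suppose $r^2<\delta<(r+1)^2$ and $\delta-r$ is even. Let $m,n,q$ be integers with $m\geq(\delta-r)/2$, $q\geq(\delta-r)/2$ and $n=r+1$. Put $\tau_1:=m-(\delta-r)/2$, $\tau_2:=q-(\delta-r)/2$ and $d:=\delta+\tau_1+\tau_2$ (so that $m+n+q=d+1$). Then for every triple of nonnegative integers $(m^*,n^*,q^* )$ with $m^*+n^*+q^*=d-2$, $m^*\geq\tau_1$ and $q^*\geq\tau_2$, the sign pattern $\Sigma_{m,n,q}$ is realizable by a degree $d$ hyperbolic polynomial, with pairwise distinct moduli of roots, having these values of $m^*,n^*,q^*$. (3) Suppose $\delta=r^2$, let $\tau_1,\tau_2\geq 0$ be integers and put $d:=\delta+\tau_1+\tau_2$. Then the sign pattern $$\Sigma_{\tau_1+r(r-1)/2+1,\; r,\; \tau_2+r(r-1)/2}\qquad\Bigl(\text{resp.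 } \Sigma_{\tau_1+r(r-1)/2,\; r,\; \tau_2+r(r-1)/2+1}\Bigr)$$ is realizable by degree $d$ hyperbolic polynomials, with pairwise distinct moduli of roots, having any prescribed nonnegative integer values of $m^*,n^*,q^*$ such that $m^*+n^*+q^*=d-2$, $m^*\geq\tau_1+1$ and $q^*\geq\tau_2$ (resp. $m^*\geq\tau_1$ and $q^*\geq\tau_2+1$).
   Context: All polynomials are real, univariate, monic, with all coefficients nonvanishing. Such a polynomial is a hyperbolic polynomial (HP) if all its roots are real. The sign pattern (SP) of $P=\sum_{j=0}^d a_jx^j$ ($a_d=1$, all $a_j\in\mathbb{R}\setminus\{0\}$) is $\sigma(P)=(+,\mathrm{sgn}(a_{d-1}),\ldots,\mathrm{sgn}(a_0))$; an SP $\sigma$ is realizable by $P$ if $\sigma(P)=\sigma$. For positive integers $m,n,q$ with $m+n+q=d+1$, $\Sigma_{m,n,q}$ denotes the SP consisting of $m$ signs $+$, followed by $n$ signs $-$, followed by $q$ signs $+$. By Descartes' rule of signs, an HP of degree $d$ realizing $\Sigma_{m,n,q}$ has exactly $2$ positive and $d-2$ negative roots. When the moduli of its roots are pairwise distinct, denote its positive roots by $0<\beta<\alpha$, and let $m^*$, $n^*$, $q^*$ be the numbers of its negative roots whose modulus is, respectively, larger than $\alpha$, between $\beta$ and $\alpha$, and smaller than $\beta$; thus $m^*+n^*+q^*=d-2$. *)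

(* Defs.v *)
From mathcomp Require Import all_boot all_order all_algebra.
From mathcomp Require Import reals complex.

Set Implicit Arguments.
Unset Strict Implicit.
Unset Printing Implicit Defensive.

Import Order.TTheory GRing.Theory Num.Theory.
Local Open Scope ring_scope.

Section Hyperbolic.
Variable R : realType.
Implicit Types P : {poly R}.

Definition hyperbolic P : Prop :=
  forall z : R[i], root (map_poly (real_complex R) P) z -> complex.Im z = 0.

(* [polyseq P] lists the coefficients from degree 0 upwards, whereas a sign
   pattern starts with the leading coefficient. *)
Definition sign_pattern P : seq int := rev [seq sgz c | c <- P].

(* [s] lists the roots of [P] with multiplicity, so distinct moduli force simple
   roots; [beta < alpha] are the positive roots, and [ms], [ns], [qs] count the
   negative roots of modulus larger than [alpha], between [beta] and [alpha],
   and smaller than [beta]. *)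
Definition root_moduli_order P (ms ns qs : nat) : Prop :=
  exists (s : seq R) (alpha beta : R),
    [/\ P = \prod_(x <- s) ('X - x%:P),
        uniq [seq `|x| | x <- s],
        0 < beta < alpha,
        perm_eq [seq x <- s | 0 < x] [:: beta; alpha]
      & [/\ count (fun x => (x < 0) && (alpha < `|x|)) s = ms,
            count (fun x => (x < 0) && (beta < `|x| < alpha)) s = ns
          & count (fun x => (x < 0) && (`|x| < beta)) s = qs]].

Definition realizable_by_HP (d : nat) (sigma : seq int) (ms ns qs : nat) : Prop :=
  exists P,
    [/\ P \is monic /\ size P = d.+1,
        forall j, (j <= d)%N -> P`_j != 0,
        hyperbolic P,
        sign_pattern P = sigma
      & root_moduli_order P ms ns qs].

End Hyperbolic.

Definition Sigma (m n q : nat) : seq int :=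
  nseq m (1 : int) ++ nseq n (-1 : int) ++ nseq q (1 : int).

(* Main.v *)
Require Import Defs.
From mathcomp Require Import all_boot all_order all_algebra.
From mathcomp Require Import reals complex ring lra zify.

(** Why the theorem is true.  Put all the roots at modulus 1: the polynomial
    (x - 1)^2 (x + 1)^N, of degree D = N + 2, has coefficient of x^j equal to
    a positive multiple of (D - 2j)^2 - D ([coef_cluster], [sgz_cluster]).  So
    the negative coefficients are those with |D - 2j| < sqrt D, a central block
    whose length is the one of the theorem when D = delta is not a square.

    Since no coefficient vanishes, a small displacement of the roots keeps all
    the signs ([has_signs_spread]).  Displacing the D roots of modulus 1 to the
    moduli 1 + i e, i < D, one is free to choose which two of them are
    positive, and so every order of the moduli occurs
    ([root_moduli_order_spread]).

    If D = r^2, exactly two coefficients vanish, those with D - 2j = r and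
    D - 2j = - r.  Moving one negative root from -1 to -(1 + e) or to
    -(1 - e) adds a small multiple of (x - 1)^2 (x + 1)^(N - 1), whose
    coefficients at these two places have opposite signs.  Hence one of the two
    joins the negative block and the other one does not, according to the
    direction of the move ([admissible_square]); the moved root is the reason
    why one of the lower bounds on the numbers of negative roots goes up by 1.

    Finally, a negative root of huge modulus adds one sign + in front of the
    sign pattern and a negative root of tiny modulus adds one at its end
    ([admissible_large], [admissible_small]); these account for tau1 and tau2.

    The three stages are combined in [realizable_of_admissible]: first the
    isolated negative roots are fixed, then the cluster left at modulus 1 is
    spread at a scale smaller than its distance to all of them. *)

Section Perturbation.
Set Implicit Arguments.
Unset Strict Implicit.
Unset Printing Implicit Defensive.
Import Order.TTheory GRing.Theory Num.Theory.
Local Open Scope ring_scope.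
Variable R : realType.
Implicit Types (P Q : {poly R}) (h : seq R) (e y : R).

(** * Sign patterns read on coefficients *)

(** Indexed from the constant term upwards, so that the pattern is a statement
    about individual coefficients, the form in which perturbations act. *)
Definition has_signs P (m n q : nat) : Prop :=
  size P = (m + n + q)%N /\
  forall j, (j < m + n + q)%N ->
    sgz P`_j = if (q <= j < q + n)%N then (-1)%Z else 1%Z.

Lemma has_signs_neq0 P m n q j :
  has_signs P m n q -> (j < m + n + q)%N -> P`_j != 0.
Proof. by case=> _ sP /sP; rewrite -sgz_eq0; case: ifP => _ ->. Qed.

Lemma has_signs_sign_pattern P m n q :
  has_signs P m n q -> sign_pattern P = Sigma m n q.
Proof.
case=> szP sP; rewrite /sign_pattern /Sigma -[RHS]revK; congr rev.
rewrite !rev_cat !rev_nseq -catA.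
apply: (@eq_from_nth _ 0) => [|j].
  by rewrite size_map !size_cat !size_nseq szP; lia.
rewrite size_map szP => lj; rewrite (nth_map 0) ?szP// sP//.
rewrite !nth_cat !size_nseq !nth_nseq.
case: (ltnP j q) => jq //=; case: (ltnP (j - q) n) => jn.
- by case: ifP => // h; move: lj jq jn h; lia.
- have -> : (j - q - n < m)%N by move: lj jq jn; lia.
  by case: ifP => // h; move: lj jq jn h; lia.
Qed.

(** * Stability of the signs of coefficients *)

(** Continuity at 0, in the form p = c + x q with q bounded on [-1, 1]. *)
Lemma sgz_near0 (p : {poly R}) : p`_0 != 0 ->
  exists2 e0, 0 < e0 & forall e, 0 < e <= e0 -> sgz p.[e] = sgz p`_0.
Proof.
elim/poly_ind: p => [|q c _]; first by rewrite coef0 eqxx.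
rewrite coefD coefMX coefC /= add0r => c0.
have [b hb] := poly_disk_bound q 1.
have b_ge0 : 0 <= b by apply: le_trans (hb 0 _); rewrite ?normr0.
have c_gt0 : 0 < `|c| by rewrite normr_gt0.
exists (Num.min 1 (`|c| / (b + 1))) => [|e].
  by rewrite lt_min ltr01 divr_gt0//; lra.
rewrite le_min => /and3P[e_gt0 e_le1].
rewrite ler_pdivlMr => [e_le|]; last by lra.
have := hb e; rewrite ger0_norm ?(ltW e_gt0)// => /(_ e_le1).
rewrite hornerMXaddC; move: q.[e] => x; rewrite ler_norml => /andP[x_ge x_le].
move: c0 e_le; rewrite neq_lt => /orP[c0|c0].
  by rewrite ltr0_norm// => e_le; rewrite !ltr0_sgz//; nra.
by rewrite gtr0_norm// => e_le; rewrite !gtr0_sgz//; nra.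
Qed.

Lemma sgz_family_near0 (p : nat -> {poly R}) N :
  (forall j, (j < N)%N -> (p j)`_0 != 0) ->
  exists2 e0, 0 < e0 & forall e, 0 < e <= e0 ->
    forall j, (j < N)%N -> sgz (p j).[e] = sgz (p j)`_0.
Proof.
elim: N => [|N IH] p0; first by exists 1.
have [j /ltnW/p0//|e1 e1_gt0 he1] := IH.
have [e2 e2_gt0 he2] := sgz_near0 (p0 N (ltnSn N)).
exists (Num.min e1 e2) => [|e]; first by rewrite lt_min e1_gt0.
rewrite le_min => /and3P[e_gt0 le1 le2] j.
rewrite ltnS leq_eqVlt => /orP[/eqP->|jN]; first by rewrite he2 ?e_gt0.
by rewrite he1 ?e_gt0.
Qed.

(** First-order perturbation: a vanishing coefficient of P takes the sign of the
    coefficient of the perturbation.  Adding a huge or a tiny root and moving one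
    root of the cluster are all instances of this. *)
Lemma sgz_coef_perturb P Q N :
  exists2 e0, 0 < e0 & forall e, 0 < e <= e0 -> forall j, (j < N)%N ->
    sgz (P`_j + e * Q`_j) = if P`_j == 0 then sgz Q`_j else sgz P`_j.
Proof.
(* The constant term of [p j] is never zero: if P`_j vanishes, the sign of the
   sum for e > 0 is the one of Q`_j, and 1 is a dummy if both vanish. *)
pose p j := if P`_j == 0 then (if Q`_j == 0 then 1 else (Q`_j)%:P)
            else (P`_j)%:P + Q`_j *: 'X.
have [j _|e0 e0_gt0 he0] := @sgz_family_near0 p N.
  rewrite /p; case: (eqVneq P`_j 0) => [_|Pj].
    by case: (eqVneq Q`_j 0) => [_|Qj]; rewrite ?coef1 ?oner_eq0 ?coefC.
  by rewrite coefD coefZ coefX mulr0 addr0 coefC.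
exists e0 => // e he j /(he0 e he j); rewrite /p.
case: (eqVneq P`_j 0) => [->|_]; last first.
  rewrite hornerD hornerZ hornerX hornerC coefD coefZ coefX mulr0 addr0.
  by rewrite coefC mulrC.
by case/andP: he => e_gt0 _ _; rewrite add0r sgzM gtr0_sgz ?mul1r.
Qed.

(** * Adding negative roots of extreme modulus *)

Definition poly_of_roots (s : seq R) : {poly R} := \prod_(x <- s) ('X - x%:P).

Lemma coef_mul_root P y j :
  (('X - (- y)%:P) * P)`_j = (P * 'X)`_j + y * P`_j.
Proof. by rewrite mulrC polyCN opprK mulrDr coefD coefMC mulrC [_ * y]mulrC. Qed.

Lemma size_mul_root P y m n q : has_signs P m n q -> (0 < m + n + q)%N ->
  size (('X - (- y)%:P) * P) = (m + n + q).+1.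
Proof.
move=> [szP _] d_gt0; rewrite mulrC size_Mmonic ?monicXsubC//; last first.
  by rewrite -size_poly_gt0 szP.
by rewrite size_XsubC szP addn2.
Qed.

(** Up to the factor y, multiplying P by x + y adds y^-1 x P to P; this only
    matters in degree [size P], where P has no coefficient and x P is monic. *)
Lemma add_large_root P m n q b : P \is monic -> has_signs P m n q ->
  exists2 y, b < y & has_signs (('X - (- y)%:P) * P) m.+1 n q.
Proof.
move=> monP hP; have [szP sP] := hP.
have d_gt0 : (0 < m + n + q)%N by rewrite -szP size_poly_gt0 monic_neq0.
have [e0 e0_gt0 he0] := sgz_coef_perturb P (P * 'X) (m + n + q).+1.
pose e := Num.min e0 (1 + `|b|)^-1.
have b1 : 0 < 1 + `|b| by rewrite ltr_pwDl.
have e_gt0 : 0 < e by rewrite lt_min e0_gt0 invr_gt0.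
exists e^-1.
  have : 1 + `|b| <= e^-1.
    by rewrite -[leLHS]invrK lef_pV2 ?posrE ?invr_gt0// ge_min lexx orbT.
  by have := ler_norm b; lra.
split=> [|j lj]; first by rewrite (size_mul_root _ hP).
have -> : (('X - (- e^-1)%:P) * P)`_j = e^-1 * (P`_j + e * (P * 'X)`_j).
  by rewrite coef_mul_root mulrDr mulKf ?gt_eqF// addrC.
rewrite sgzM gtr0_sgz ?invr_gt0// mul1r he0 ?e_gt0 ?ge_min ?lexx//.
case: (ltnP j (m + n + q)) => jd.
  by rewrite (negPf (has_signs_neq0 hP jd)) sP.
have -> : j = (m + n + q)%N by move: lj jd; lia.
rewrite nth_default ?szP// eqxx coefMX gtn_eqF//.
move: monP; rewrite monicE lead_coefE szP => /eqP->.
by rewrite sgz1; case: ifP => //; lia.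
Qed.

(** Multiplying P by x + y adds y P to x P; this only matters in degree 0, where
    the new coefficient has the sign of the constant term of P, which is positive
    because q > 0. *)
Lemma add_small_root P m n q b : (0 < q)%N -> 0 < b -> has_signs P m n q ->
  exists2 y, 0 < y < b & has_signs (('X - (- y)%:P) * P) m n q.+1.
Proof.
move=> q_gt0 b_gt0 hP; have [szP sP] := hP.
have [e0 e0_gt0 he0] := sgz_coef_perturb (P * 'X) P (m + n + q).+1.
pose e := Num.min e0 (b / 2%:R).
have e_gt0 : 0 < e by rewrite lt_min e0_gt0 divr_gt0.
exists e.
  by rewrite e_gt0 gt_min [X in _ || X](_ : _ = true) ?orbT//; lra.
split=> [|j lj]; first by rewrite (size_mul_root _ hP) ?addnS//; lia.
rewrite coef_mul_root he0 ?e_gt0 ?ge_min ?lexx//; last by move: lj; lia.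
rewrite coefMX; case: j lj => [|j] lj /=.
  by rewrite eqxx sP; [case: ifP => //; lia | lia].
have lj' : (j < m + n + q)%N by move: lj; lia.
by rewrite (negPf (has_signs_neq0 hP lj')) sP// ltnS addSn ltnS.
Qed.

(** The negative roots in [h], given by their moduli, are already in their final
    position; the other roots still have modulus 1. *)
Definition nearly_clustered_roots h N := map -%R h ++ [:: 1, 1 & nseq N (-1)].

Local Notation nb_large h := (count (fun y => 1 < y) h).
Local Notation nb_small h := (count (fun y => y < 1) h).

Definition admissible h N m n q : Prop :=
  [/\ uniq h, forall y, y \in h -> 0 < y /\ y != 1
    & has_signs (poly_of_roots (nearly_clustered_roots h N)) m n q].

Lemma exists_pos_lower_bound h : (forall y, y \in h -> 0 < y) ->
  exists2 b, 0 < b & forall y, y \in h -> b < y.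
Proof.
elim: h => [|x h IH] h_gt0; first by exists 1.
have [y yh|b b_gt0 hb] := IH; first by rewrite h_gt0// inE yh orbT.
have x_gt0 : 0 < x by rewrite h_gt0// mem_head.
exists (Num.min b (x / 2%:R)) => [|y]; first by rewrite lt_min b_gt0 divr_gt0.
rewrite inE gt_min => /orP[/eqP->|/hb->//].
by apply/orP; right; lra.
Qed.

Lemma exists_upper_bound h : exists b, forall y, y \in h -> y < b.
Proof.
elim: h => [|x h [b hb]]; first by exists 0.
exists (Num.max b (x + 1)) => y.
rewrite inE lt_max => /orP[/eqP->|/hb->//].
by apply/orP; right; lra.
Qed.

Lemma poly_of_roots_cons x s :
  poly_of_roots (x :: s) = ('X - x%:P) * poly_of_roots s.
Proof. exact: big_cons. Qed.

Lemma admissible_large h N m n q t : admissible h N m n q ->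
  exists h', [/\ admissible h' N (m + t) n q,
    nb_large h' = (nb_large h + t)%N & nb_small h' = nb_small h].
Proof.
move=> ah; elim: t => [|t [h' [[uh h_gt0 sh] cg cl]]].
  by exists h; rewrite !addn0.
have [b hb] := exists_upper_bound (1 :: h').
have [|y b_y sy] := @add_large_root _ _ _ _ b _ sh.
  exact: monic_prod_XsubC.
have y1 : 1 < y by apply: lt_trans b_y; rewrite hb ?mem_head.
exists (y :: h'); split.
- split; last by rewrite addnS /nearly_clustered_roots /= poly_of_roots_cons.
  + rewrite /= uh andbT; apply/negP => yh.
    have := hb y; rewrite inE yh orbT => /(_ isT).
    by rewrite ltNge (ltW b_y).
  + move=> z; rewrite inE => /orP[/eqP->|/h_gt0//].
    by split; [apply: lt_trans y1 | rewrite gt_eqF].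
- by rewrite /= y1 cg; lia.
- by rewrite /= ltNge (ltW y1) cl.
Qed.

Lemma admissible_small h N m n q t : (0 < q)%N -> admissible h N m n q ->
  exists h', [/\ admissible h' N m n (q + t),
    nb_large h' = nb_large h & nb_small h' = (nb_small h + t)%N].
Proof.
move=> q_gt0 ah; elim: t => [|t [h' [[uh h_gt0 sh] cg cl]]].
  by exists h; rewrite !addn0.
have [y|b b_gt0 hb] := @exists_pos_lower_bound (1 :: h').
  by rewrite inE => /orP[/eqP->|/h_gt0[]].
have [||y /andP[y_gt0 y_b] sy] := @add_small_root _ _ _ _ b _ _ sh => //.
  by rewrite addn_gt0 q_gt0.
have y1 : y < 1 by apply: (lt_trans y_b); rewrite hb ?mem_head.
exists (y :: h'); split.
- split; last by rewrite addnS /nearly_clustered_roots /= poly_of_roots_cons.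
  + rewrite /= uh andbT; apply/negP => yh.
    by have := hb y; rewrite inE yh orbT => /(_ isT); rewrite ltNge (ltW y_b).
  + move=> z; rewrite inE => /orP[/eqP->|/h_gt0//].
    by rewrite lt_eqF.
- by rewrite /= ltNge (ltW y1) cg.
- by rewrite /= y1 cl; lia.
Qed.

(** * The polynomial (x - 1)^2 (x + 1)^N *)

Lemma coef_X1_exp n j : (('X + 1 : {poly R}) ^+ n)`_j = 'C(n, j)%:R.
Proof.
have -> : ('X + 1 : {poly R}) ^+ n = \poly_(i < n.+1) 'C(n, i)%:R.
  by rewrite exprD1n poly_def; apply: eq_bigr => i _; rewrite scaler_nat.
by rewrite coef_poly; case: ltnP => // ltnj; rewrite bin_small.
Qed.

Definition cluster N : {poly R} := poly_of_roots [:: 1, 1 & nseq N (-1)].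

(** (x - 1)^2 = (x + 1)^2 - 4x leaves only two binomial coefficients in each
    coefficient of the product. *)
Lemma clusterE N : cluster N = ('X + 1) ^+ N.+2 - ('X + 1) ^+ N * 'X *+ 4.
Proof.
rewrite /cluster !poly_of_roots_cons.
have -> : poly_of_roots (nseq N (-1)) = ('X + 1) ^+ N.
  rewrite /poly_of_roots big_nseq -polyC1 polyCN opprK.
  by elim: N => //= n ->; rewrite exprS.
by rewrite !exprS polyC1; ring.
Qed.

(** With D = N + 2, D (D - 1) 'C(D - 2, j - 1) = j (D - j) 'C(D, j) makes 'C(D, j)
    a common factor; the other one is D (D - 1) - 4 j (D - j) = (D - 2j)^2 - D. *)
Lemma coef_cluster N j : (N.+2 * N.+1)%:R * (cluster N)`_j =
  'C(N.+2, j)%:R * ((N.+2%:R - 2 * j%:R) ^+ 2 - N.+2%:R).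
Proof.
rewrite clusterE coefB coefMn coefMX !coef_X1_exp.
case: j => [|j] /=; first by rewrite bin0 mul0rn natrM -!natr1; ring.
case: (ltnP N.+1 j) => [ltNj|leN]; first by rewrite !bin_small//; first ring; lia.
have : (N.+2 * N.+1 * 'C(N, j) = j.+1 * (N.+1 - j) * 'C(N.+2, j.+1))%N.
  by have := mul_bin_diag N.+2 j; have := mul_bin_down N.+1 j => /=; nia.
move=> /(congr1 (fun n => n%:R : R)); rewrite !natrM natrB// -!natr1.
move: 'C(N, j)%:R 'C(N.+2, j.+1)%:R => x y e.
rewrite [LHS](_ : _ = (N%:R + 1 + 1) * (N%:R + 1) * y -
                     4 * ((N%:R + 1 + 1) * (N%:R + 1) * x)); last by ring.
by rewrite e; ring.
Qed.

Lemma sgz_cluster N j : (j <= N.+2)%N ->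
  sgz (cluster N)`_j = sgz (((N.+2)%:Z - 2 * j%:Z) ^+ 2 - (N.+2)%:Z).
Proof.
move=> lej; have := coef_cluster N j => /(congr1 (@sgz R)).
rewrite !sgzM [sgz _%:R]gtr0_sgz ?ltr0n//.
rewrite [sgz 'C(_, _)%:R]gtr0_sgz ?ltr0n ?bin_gt0//.
rewrite !mul1r => ->.
rewrite -[RHS](sgz_int R); congr sgz.
by rewrite rmorphB rmorphXn rmorphB rmorphM.
Qed.

Lemma size_nearly_clustered h N :
  size (poly_of_roots (nearly_clustered_roots h N)) = (size h + N).+3.
Proof. by rewrite size_prod_XsubC size_cat /= size_map size_nseq !addnS. Qed.

(** Whatever the parity of D - r, the integers of the parity of D in [-r, r] are
    the values of D - 2j for q <= j < q + n; the two cases for n are those of r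
    with a parity different from, or equal to, that of D. *)
Lemma admissible_cluster N r n q : (N.+3 = q + n + q)%N ->
  (r ^ 2 < N.+2 < (r + 1) ^ 2)%N -> n = r \/ n = r.+1 ->
  admissible [::] N q n q.
Proof.
move=> eqd ltd n_r; split=> //; split; first by rewrite size_nearly_clustered.
move=> j ltj; rewrite sgz_cluster; last by lia.
by case: ifP => hj; [rewrite ltr0_sgz|rewrite gtr0_sgz]=> //; case: n_r; nia.
Qed.

(** For D = r^2 the coefficients with D - 2j = r and D - 2j = - r vanish.  The
    polynomial with one root -1 fewer has there the signs of
    (r - 1)^2 - (r^2 - 1) < 0 and (r + 1)^2 - (r^2 - 1) > 0.  Moving that root
    away from 0 (b true) adds a positive multiple of it, moving it towards 0
    subtracts one. *)
Lemma admissible_square N r w (b : bool) : (1 < r)%N -> (N.+3 = r ^ 2)%N ->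
  (2 * w + r = r ^ 2)%N ->
  exists y, [/\ admissible [:: y] N (w + b) r (w + ~~ b),
    (1 < y) = b & (y < 1) = ~~ b].
Proof.
move=> r_gt1 eqN eqw; pose s : R := if b then 1 else -1.
have [e0 e0_gt0 he0] := sgz_coef_perturb (cluster N.+1) (s *: cluster N) N.+4.
pose e := Num.min e0 (1 / 2).
have e_gt0 : 0 < e by rewrite lt_min e0_gt0 divr_gt0.
have e_lt1 : e < 1 by rewrite gt_min; apply/orP; right; lra.
exists (1 + e * s); split; last 2 first.
- by rewrite /s; case: b {s he0} => /=; apply/idP; lra.
- by rewrite /s; case: b {s he0} => /=; apply/idP; lra.
split=> //.
  by move=> y; rewrite inE => /eqP->; rewrite neq_lt /s; case: b {s he0}; split;
    solve [lra | apply/orP; left; lra | apply/orP; right; lra].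
split; first by rewrite size_nearly_clustered /=; case: (b); lia.
have -> : poly_of_roots (nearly_clustered_roots [:: 1 + e * s] N) =
          cluster N.+1 + e *: (s *: cluster N).
  rewrite poly_of_roots_cons -[poly_of_roots _]/(cluster N) !clusterE.
  by rewrite -!mul_polyC !exprS !polyCN !polyCD !polyCM polyC1; ring.
move=> j ltj; have ltj4 : (j < N.+4)%N by move: ltj; case: (b); lia.
rewrite coefD coefZ he0 ?e_gt0 ?ge_min ?lexx//.
rewrite -sgz_eq0 sgz_cluster ?sgz_eq0; last by lia.
case: eqP => [kr|k_r]; last first.
  by case: ifP => hj; [rewrite ltr0_sgz|rewrite gtr0_sgz]=> //;
    case: b hj {s he0 ltj}; nia.
rewrite coefZ sgzM sgz_cluster; last by nia.
have {kr} [kr|kr] : (2 * j = r ^ 2 + r)%N \/ (2 * j + r = r ^ 2)%N by nia.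
(* N + 2 = r^2 - 1, hence the strict signs at both places. *)
- have -> : sgz (((N.+2)%:Z - 2 * j%:Z) ^+ 2 - (N.+2)%:Z) = 1.
    by apply: gtr0_sgz; nia.
  rewrite /s mulr1; case: b {s he0 ltj} => /=.
    by rewrite sgz1; case: ifP => //; nia.
  by rewrite sgzN1; case: ifP => //; nia.
- have -> : sgz (((N.+2)%:Z - 2 * j%:Z) ^+ 2 - (N.+2)%:Z) = -1.
    by apply: ltr0_sgz; nia.
  rewrite /s mulrN1; case: b {s he0 ltj} => /=.
    by rewrite sgz1; case: ifP => //; nia.
  by rewrite sgzN1; case: ifP => //; nia.
Qed.

(** * Spreading the cluster *)

(** The roots are enumerated by increasing modulus 1 + i e.  The ring is
    arbitrary because e is specialized both to real numbers and to the variable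
    'X, which exhibits the coefficients of the spread polynomial as polynomials
    in e. *)
Definition spread (T : nzRingType) (e : T) (qs ns ms : nat) : seq T :=
  [seq - (1 + i%:R * e) | i <- iota 0 qs] ++
  (1 + qs%:R * e) :: [seq - (1 + i%:R * e) | i <- iota qs.+1 ns] ++
  (1 + (qs + ns).+1%:R * e) ::
    [seq - (1 + i%:R * e) | i <- iota (qs + ns).+2 ms].

Lemma map_spread (T T' : nzRingType) (f : {rmorphism T -> T'}) (e : T)
    qs ns ms :
  map f (spread e qs ns ms) = spread (f e) qs ns ms.
Proof.
have fE i : f (1 + i%:R * e) = 1 + i%:R * f e.
  by rewrite rmorphD rmorphM rmorph1 rmorph_nat.
rewrite /spread !(map_cat, map_cons) -!map_comp !fE.
by congr (_ ++ _ :: _ ++ _ :: _); apply: eq_map => i /=; rewrite rmorphN fE.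
Qed.

Lemma spread0 qs ns ms :
  perm_eq (spread (0 : R) qs ns ms) [:: 1, 1 & nseq (ms + ns + qs) (-1)].
Proof.
rewrite /spread !mulr0 !addr0.
have const a k : [seq - (1 + i%:R * 0) | i <- iota a k] = nseq k (-1 : R).
  elim: k a => //= k IH a; by rewrite mulr0 addr0 IH.
rewrite !const; apply/permP => a.
rewrite !(count_cat, count_nseq) /= !count_cat /= !count_nseq.
by case: (a (-1)); case: (a 1); rewrite ?mul1n ?mul0n; lia.
Qed.

Lemma norm_spread e qs ns ms : 0 <= e ->
  [seq `|x| | x <- spread e qs ns ms] =
  [seq 1 + i%:R * e | i <- iota 0 (qs + ns + ms).+2].
Proof.
move=> e_ge0; have g i : 0 <= 1 + i%:R * e by rewrite addr_ge0 ?mulr_ge0.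
have -> : (qs + ns + ms).+2 = (qs + (1 + (ns + (1 + ms))))%N by lia.
rewrite /spread !iotaD /= !(map_cat, map_cons) -!map_comp.
have -> : ((0 + qs + 1 + ns + 1) = (qs + ns).+2)%N by lia.
have -> : ((0 + qs + 1 + ns) = (qs + ns).+1)%N by lia.
rewrite addn1 add0n !ger0_norm//; congr (_ ++ _ :: _ ++ _ :: _);
  by apply: eq_map => i /=; rewrite normrN ger0_norm.
Qed.

Lemma count_spread (a : pred R) (b : pred nat) e qs ns ms :
  (forall i, a (- (1 + i%:R * e)) = b i) -> (forall i, ~~ a (1 + i%:R * e)) ->
  count a (spread e qs ns ms) = (count b (iota 0 qs) +
    count b (iota qs.+1 ns) + count b (iota (qs + ns).+2 ms))%N.
Proof.
move=> ab na; rewrite /spread !count_cat /= !count_cat /=.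
rewrite !(negPf (na _)) !add0n addnA !count_map.
by congr (_ + _ + _)%N; apply: eq_count => i /=; rewrite ab.
Qed.

Lemma count_iota (b : pred nat) (c : bool) i k :
  (forall j, (i <= j < i + k)%N -> b j = c) -> count b (iota i k) = (c * k)%N.
Proof.
move=> bc; have /eq_in_count-> : {in iota i k, b =1 fun=> c}.
  by move=> j; rewrite mem_iota => /bc.
by case: c {bc}; rewrite ?count_predT ?size_iota ?mul1n// count_pred0.
Qed.

Lemma hyperbolic_poly_of_roots s : hyperbolic (poly_of_roots s).
Proof.
move=> z; rewrite /poly_of_roots rmorph_prod.
rewrite (eq_bigr (fun x => 'X - (real_complex R x)%:P)); last first.
  by move=> x _; rewrite /= map_polyXsubC.
by rewrite -(big_map (real_complex R) predT (fun x => 'X - x%:P)) root_prod_XsubC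
  => /mapP[x _ ->].
Qed.

(** The coefficients depend polynomially on e, hence keep near 0 the nonzero
    signs that they have at 0, where the spread roots are all in the cluster. *)
Lemma has_signs_spread h m n q qs ns ms :
  has_signs (poly_of_roots (nearly_clustered_roots h (ms + ns + qs))) m n q ->
  exists2 e0, 0 < e0 & forall e, 0 < e <= e0 ->
    has_signs (poly_of_roots (map -%R h ++ spread e qs ns ms)) m n q.
Proof.
move=> hP; pose rs := map polyC (map -%R h) ++ spread 'X qs ns ms.
pose P := \prod_(x <- rs) ('X - x%:P).
have evalP e :
    map_poly (horner_eval e) P = poly_of_roots (map -%R h ++ spread e qs ns ms).
  rewrite /P rmorph_prod; under eq_bigr => x _ do rewrite /= map_polyXsubC.
  rewrite -(big_map (horner_eval e) predT (fun x => 'X - x%:P)).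
  rewrite map_cat map_spread.
  have /mapK-> : cancel polyC (horner_eval e).
    by move=> c; rewrite horner_evalE hornerC.
  by rewrite [X in spread X]horner_evalE hornerX.
have P0 :
    map_poly (horner_eval 0) P = poly_of_roots (nearly_clustered_roots h (ms + ns + qs)).
  by rewrite evalP; apply: perm_big; rewrite perm_cat2l spread0.
have coefP e j : (map_poly (horner_eval e) P)`_j = (P`_j).[e] by rewrite coef_map.
have [szP sP] := hP.
have [j lj|e0 e0_gt0 he0] := @sgz_family_near0 (fun j => P`_j) (m + n + q).
  by rewrite -horner_coef0 -coefP P0 (has_signs_neq0 hP).
exists e0 => // e he; split.
  rewrite -szP !size_prod_XsubC !size_cat /= !size_cat /=.
  by rewrite !(size_map, size_iota, size_nseq); lia.
by move=> j lj; rewrite -evalP coefP he0// -horner_coef0 -coefP P0 sP.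
Qed.

(** The hypothesis on [h] says that the spread cluster does not reach the
    isolated roots: these stay on the same side of all of it.  The moduli below 1
    need no such margin, the cluster being spread outwards only. *)
Lemma root_moduli_order_spread h e qs ns ms : 0 < e -> uniq h ->
  (forall y, y \in h -> 0 < y) ->
  (forall y, y \in h -> y < 1 \/ 1 + (qs + ns + ms).+2%:R * e < y) ->
  root_moduli_order (poly_of_roots (map -%R h ++ spread e qs ns ms))
    (ms + nb_large h) ns (qs + nb_small h).
Proof.
move=> e_gt0 uh h_gt0 h_far.
have rad_ge1 i : 1 <= 1 + i%:R * e by rewrite lerDl mulr_ge0 ?ler0n ?ltW.
have rad_gt0 i : 0 < 1 + i%:R * e by apply: lt_le_trans (rad_ge1 i).
have ltrad i j : (1 + i%:R * e < 1 + j%:R * e) = (i < j)%N.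
  by rewrite ltrD2l ltr_pM2r// ltr_nat.
have norm_rad i : `|1 + i%:R * e| = 1 + i%:R * e by rewrite gtr0_norm.
pose al := 1 + (qs + ns).+1%:R * e; pose be := 1 + qs%:R * e.
have far y i : (i <= (qs + ns + ms).+2)%N -> y \in h ->
    ((1 + i%:R * e < y) = (1 < y)) * ((y < 1 + i%:R * e) = (y < 1)).
  move=> lei yh; have : 1 + i%:R * e <= 1 + (qs + ns + ms).+2%:R * e.
    by rewrite lerD2l ler_pM2r// ler_nat.
  have := rad_ge1 i; case: (h_far y yh) => hy le1 lei'; split; apply/idP/idP; lra.
exists (map -%R h ++ spread e qs ns ms), al, be.
split=> //.
- rewrite map_cat norm_spread ?ltW// -map_comp.
  have -> : map (@Num.norm R R \o -%R) h = h.
    rewrite -[RHS]map_id; apply/eq_in_map => y yh /=.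
    by rewrite normrN gtr0_norm ?h_gt0.
  rewrite cat_uniq; apply/and3P; split=> //; last first.
    rewrite map_inj_uniq ?iota_uniq// => i j.
    by move=> /addrI /(mulIf (lt0r_neq0 e_gt0)) /eqP; rewrite eqr_nat => /eqP.
  rewrite has_map; apply/hasPn => i; rewrite mem_iota => /andP[_ lei] /=.
  apply/negP => /h_far[]; first by rewrite ltNge rad_ge1.
  by rewrite ltrad; move: lei; lia.
- by rewrite rad_gt0 ltrad; lia.
- have pos_neg i : (0 < - (1 + i%:R * e)) = false by rewrite oppr_gt0 ltNge ltW.
  have pos_iota a k :
      [seq x <- [seq - (1 + i%:R * e) | i <- iota a k] | 0 < x] = [::].
    rewrite (eq_in_filter (a2 := pred0)) ?filter_pred0// => x /mapP[i _ ->].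
    by rewrite pos_neg.
  rewrite /spread !filter_cat /= !filter_cat /= !rad_gt0 !pos_iota.
  rewrite (eq_in_filter (a2 := pred0)) ?filter_pred0// => x /mapP[y /h_gt0 y0 ->].
  by rewrite oppr_gt0 ltNge ltW.
have neg_rad i : - (1 + i%:R * e) < 0 by rewrite oppr_lt0.
have pos_rad i : (1 + i%:R * e < 0) = false by rewrite ltNge ltW.
split; rewrite count_cat count_map addnC.
- rewrite (@count_spread _ (fun i => (qs + ns).+1 < i)%N); first last.
  + by move=> i; rewrite pos_rad.
  + by move=> i; rewrite neg_rad normrN norm_rad ltrad.
  rewrite [count _ (iota (qs + ns).+2 ms)](count_iota (c := true));
    last by move=> j; lia.
  rewrite !(count_iota (c := false)); [|by move=> j; lia..].
  rewrite !mul0n mul1n !add0n; congr (_ + _)%N; apply: eq_in_count => y yh /=.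
  by rewrite oppr_lt0 h_gt0// normrN gtr0_norm ?h_gt0// far//; lia.
- rewrite (@count_spread _ (fun i => qs < i < (qs + ns).+1)%N); first last.
  + by move=> i; rewrite pos_rad.
  + by move=> i; rewrite neg_rad normrN norm_rad !ltrad.
  rewrite [count _ (iota 0 qs)](count_iota (c := false));
    last by move=> j; lia.
  rewrite [count _ (iota qs.+1 ns)](count_iota (c := true));
    last by move=> j; lia.
  rewrite (count_iota (c := false)); last by move=> j; lia.
  rewrite !mul0n mul1n add0n addn0 (eq_in_count (a2 := pred0)) ?count_pred0 ?addn0//.
  move=> y yh /=; apply/negP; rewrite normrN gtr0_norm ?h_gt0// => /and3P[_].
  by rewrite !far//; [case: ltgtP | lia | lia].
- rewrite (@count_spread _ (fun i => i < qs)%N); first last.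
  + by move=> i; rewrite pos_rad.
  + by move=> i; rewrite neg_rad normrN norm_rad !ltrad.
  rewrite [count _ (iota 0 qs)](count_iota (c := true));
    last by move=> j; lia.
  rewrite !(count_iota (c := false)); [|by move=> j; lia..].
  rewrite !mul0n mul1n !addn0; congr (_ + _)%N; apply: eq_in_count => y yh /=.
  by rewrite oppr_lt0 h_gt0// normrN gtr0_norm ?h_gt0// far//; lia.
Qed.

(** * Realizability *)

Lemma realizable_of_admissible h m n q t1 t2 ms ns qs : (0 < q)%N ->
  admissible h (ms + ns + qs) m n q ->
  realizable_by_HP R (m + t1 + n + (q + t2)).-1 (Sigma (m + t1) n (q + t2))
    (ms + nb_large h + t1) ns (qs + nb_small h + t2).
Proof.
move=> q_gt0 /(admissible_small t2 q_gt0)[h1 [/(admissible_large t1)]].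
move=> [h' [[uh h_ok hP] large_h' small_h'] large_h1 small_h1].
have h_gt0 y : y \in h' -> 0 < y by case/h_ok.
have [e1 e1_gt0 he1] := has_signs_spread hP.
pose K : R := (qs + ns + ms).+2%:R.
have K_gt0 : 0 < K by rewrite ltr0n.
(* e < b keeps the cluster, of moduli less than 1 + K e, below every modulus y > 1
   of an isolated root. *)
have [y|b b_gt0 hb] :=
    @exists_pos_lower_bound [seq (y - 1) / K | y <- h' & 1 < y].
  case/mapP=> z; rewrite mem_filter => /andP[z1 _] ->.
  by rewrite divr_gt0// subr_gt0.
pose e := Num.min e1 b.
have e_gt0 : 0 < e by rewrite lt_min e1_gt0.
have /he1 sP : 0 < e <= e1 by rewrite e_gt0 ge_min lexx.
exists (poly_of_roots (map -%R h' ++ spread e qs ns ms)); split.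
- split; first exact: monic_prod_XsubC.
  by case: sP => -> _; lia.
- by move=> j lej; apply: (has_signs_neq0 sP); lia.
- exact: hyperbolic_poly_of_roots.
- exact: has_signs_sign_pattern.
rewrite -!addnA -small_h1 -large_h1 -small_h' -large_h'.
apply: root_moduli_order_spread => // y yh.
have [y_gt0] := h_ok y yh; rewrite neq_lt => /orP[|y_gt1]; [by left|right].
have /hb : (y - 1) / K \in [seq (y - 1) / K | y <- h' & 1 < y].
  by apply: map_f; rewrite mem_filter y_gt1.
rewrite ltr_pdivlMr// => bK.
have : e * K <= b * K by rewrite ler_pM2r// ge_min lexx orbT.
by rewrite mulrC -/K; lra.
Qed.
End Perturbation.

Theorem theorem3 (R : realType) (r delta : nat) (hr : 2 <= r) (hdelta : 0 < delta) :
  [/\ (r ^ 2 < delta < (r + 1) ^ 2 -> odd (delta - r) ->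
       forall m n q : nat,
         (delta - r + 1) %/ 2 <= m -> (delta - r + 1) %/ 2 <= q -> n = r ->
         let tau1 := m - (delta - r + 1) %/ 2 in
         let tau2 := q - (delta - r + 1) %/ 2 in
         let d := delta + tau1 + tau2 in
         forall ms ns qs : nat,
           ms + ns + qs = d - 2 -> tau1 <= ms -> tau2 <= qs ->
           realizable_by_HP R d (Sigma m n q) ms ns qs),
      (r ^ 2 < delta < (r + 1) ^ 2 -> ~~ odd (delta - r) ->
       forall m n q : nat,
         (delta - r) %/ 2 <= m -> (delta - r) %/ 2 <= q -> n = r + 1 ->
         let tau1 := m - (delta - r) %/ 2 in
         let tau2 := q - (delta - r) %/ 2 in
         let d := delta + tau1 + tau2 in
         forall ms ns qs : nat,
           ms + ns + qs = d - 2 -> tau1 <= ms -> tau2 <= qs ->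
           realizable_by_HP R d (Sigma m n q) ms ns qs)
    & (delta = r ^ 2 ->
       forall tau1 tau2 : nat,
         let d := delta + tau1 + tau2 in
         (forall ms ns qs : nat,
            ms + ns + qs = d - 2 -> tau1 + 1 <= ms -> tau2 <= qs ->
            realizable_by_HP R d
              (Sigma (tau1 + r * (r - 1) %/ 2 + 1) r (tau2 + r * (r - 1) %/ 2))
              ms ns qs) /\
         (forall ms ns qs : nat,
            ms + ns + qs = d - 2 -> tau1 <= ms -> tau2 + 1 <= qs ->
            realizable_by_HP R d
              (Sigma (tau1 + r * (r - 1) %/ 2) r (tau2 + r * (r - 1) %/ 2 + 1))
              ms ns qs))].
Proof.
split.
- move=> delta_r odd_dr m n q le_m le_q -> tau1 tau2 d ms ns qs.
  move=> sum_ms le_ms le_qs.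
  have adm : @admissible R [::] (ms - tau1 + ns + (qs - tau2))
      ((delta - r + 1) %/ 2) r ((delta - r + 1) %/ 2).
    by apply: (@admissible_cluster _ _ r); [| |left]; nia.
  have := realizable_of_admissible tau1 tau2 _ adm.
  rewrite /= !addn0 (subnK le_ms) (subnK le_qs) (subnKC le_m) (subnKC le_q).
  rewrite (_ : (_ + _ + _).-1 = d); last by nia.
  by apply; nia.
- move=> delta_r odd_dr m n q le_m le_q -> tau1 tau2 d ms ns qs.
  move=> sum_ms le_ms le_qs.
  have adm : @admissible R [::] (ms - tau1 + ns + (qs - tau2))
      ((delta - r) %/ 2) (r + 1) ((delta - r) %/ 2).
    by apply: (@admissible_cluster _ _ r); [| |right]; nia.
  have := realizable_of_admissible tau1 tau2 _ adm.
  rewrite /= !addn0 (subnK le_ms) (subnK le_qs) (subnKC le_m) (subnKC le_q).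
  rewrite (_ : (_ + _ + _).-1 = d); last by nia.
  by apply; nia.
- move=> delta_r tau1 tau2 d.
  have eqw : 2 * (r * (r - 1) %/ 2) + r = r ^ 2.
    have := divn_eq (r * (r - 1)) 2.
    have : (r * (r - 1)) %% 2 = 0.
      by rewrite modn2 oddM oddB ?(ltnW hr)//; case: (odd r).
    by nia.
  move: (r * (r - 1) %/ 2) eqw => w eqw.
  (* b tells whether the root that breaks the two ties is moved away from 0. *)
  have realizable (b : bool) ms ns qs : ms + ns + qs = d - 2 ->
      tau1 + b <= ms -> tau2 + ~~ b <= qs ->
      realizable_by_HP R d (Sigma (tau1 + w + b) r (tau2 + w + ~~ b)) ms ns qs.
    move=> sum_ms le_ms le_qs.
    pose N := ms - (tau1 + b) + ns + (qs - (tau2 + ~~ b)).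
    have eqN : N.+3 = r ^ 2 by rewrite /N; case: (b) le_ms le_qs; nia.
    have [y [adm y_gt1 y_lt1]] := @admissible_square R N r w b hr eqN eqw.
    have := realizable_of_admissible tau1 tau2 _ adm.
    rewrite /= y_gt1 y_lt1 !addn0.
    rewrite (_ : (_ + _ + _).-1 = d); last by case: (b); nia.
    have -> : w + b + tau1 = tau1 + w + b by lia.
    have -> : w + ~~ b + tau2 = tau2 + w + ~~ b by lia.
    have -> : ms - (tau1 + b) + b + tau1 = ms by lia.
    have -> : qs - (tau2 + ~~ b) + ~~ b + tau2 = qs by lia.
    by apply; nia.
  split=> ms ns qs sum_ms le_ms le_qs.
  + by have := realizable true ms ns qs; rewrite !addn0; apply.
  + by have := realizable false ms ns qs; rewrite !addn0; apply.
Qed.
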